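(* In the setting described in the context, let $G=T^n\langle\theta\rangle$, let $E$ be a minimal normal subgroup of $F^n{:}\langle\theta\rangle$ such that (1) $E\cong\mathbb{Z}_p^{2f}$, (2) $\langle\theta\rangle$ acts transitively on $E\setminus\{1\}$ by conjugation, and (3) $\pi_i(E)=F$ for all $i$ and $\ker(\pi_i)\cap E\ne\ker(\pi_j)\cap E$ for $1\leqslant i<j\leqslant n$; and let $H=E{:}\langle\theta\rangle$. Suppose that $N_X(\langle b,c\rangle)$ contains an involution $o$ of $T$ such that $X=\langle F,b,c,o\rangle$. Let $\mathbf{o}=(o,o,\ldots,o)\in X^n$ and $\Gamma(X)=\mathrm{Cos}(G,H,\mathbf{o})$. Then $\Gamma(X)$ is connected, $(G,2)$-arc-transitive and of valency $q^2$.
   Context: Setting: (C1) $q=p^f$ for a prime $p$ and integer $f\geqslant1$, and $n:=q+1=2^sr^t>3$ where $t\geqslant0$, $r$ is an odd prime, and either $s\geqslant2$ or $q$ is even. (C2) $X$ is an almost simple group with socle $T$, $|X:T|\leqslant2$, and $X$ has a subgroup $R\cong\mathrm{AGL}_1(q)$, written $R=F{:}(\langle b\rangle\times\langle c\rangle)$ with $F\cong\mathbb{Z}_p^f$, $b$ of order $\frac{q-1}{\gcd(2,q-1)}$ and $c$ of order $\gcd(2,q-1)$. (C3) $\tau=(1,2,\ldots,n)\in S_n$ and $W=X\wr\langle\tau\rangle=X^n{:}\langle\tau\rangle$ with $\tau^{-1}(x_1,\ldots,x_n)\tau=(x_n,x_1,\ldots,x_{n-1})$. (C4) $\pi_i:(x_1,\ldots,x_n)\mapsto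 x_i$ are the projections $X^n\to X$. Put $\mathbf{d}_0=(bc,b,bc,\ldots,bc)\in R^n$ (second coordinate $b$, all others $bc$) and $\theta=\mathbf{d}_0\tau\in W$. For a finite group $G$, a core-free subgroup $H$ and a $2$-element $g\in G\setminus H$ with $g^2\in H$, the coset graph $\mathrm{Cos}(G,H,g)$ has vertex set the set $[G:H]$ of right cosets of $H$, with $Hx$ adjacent to $Hy$ iff $yx^{-1}\in HgH$; $G$ acts on it by right multiplication. $(G,2)$-arc-transitive means $G$ is transitive on triples $(\alpha,\beta,\gamma)$ of distinct vertices with $\alpha\sim\beta\sim\gamma$. *)

(* Defs.v *)
From HB Require Import structures.
From mathcomp Require Import all_boot all_order all_algebra all_fingroup all_solvable all_field.
Set Implicit Arguments. Unset Strict Implicit. Unset Printing Implicit Defensive.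
Import GroupScope.

(* The wreath product  X wr <tau> = X^n : <tau>,  n = m.+1, realised as a    *)
(* finGroupType on pairs (x, a) standing for the element  x * tau^a  with    *)
(* x = (x_0, ..., x_{n-1}) (coordinates indexed 0..n-1 instead of 1..n) and  *)
(* a : 'I_n taken modulo n.  The multiplication is forced by                 *)
(*   tau^-1 (x_1,...,x_n) tau = (x_n, x_1, ..., x_{n-1}),                    *)
(* i.e. (tau^a y tau^-a)_i = y_(i+a), hence                                  *)
(*   (x, a) * (y, b) = ((i |-> x_i * y_(i+a)), a + b).                       *)
Section Wreath.
Variables (gT : finGroupType) (m : nat).
Local Notation I := 'I_m.+1.

Definition wreath := ({ffun I -> gT} * I)%type.
HB.instance Definition _ := Finite.on wreath.

Definition wr_mul (u v : wreath) : wreath :=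
  ([ffun i => u.1 i * v.1 (Zp_add i u.2)], Zp_add u.2 v.2).
Definition wr_one : wreath := ([ffun => 1], Zp0).
Definition wr_inv (u : wreath) : wreath :=
  ([ffun i => (u.1 (Zp_add i (Zp_opp u.2)))^-1], Zp_opp u.2).

Lemma wr_mulA : associative wr_mul.
Proof.
move=> [x a] [y b] [z c]; rewrite /wr_mul /=; congr (_, _); last by rewrite Zp_addA.
by apply/ffunP=> i; rewrite !ffunE mulgA Zp_addA.
Qed.

Lemma wr_mul1 : left_id wr_one wr_mul.
Proof.
move=> [y b]; rewrite /wr_mul /=; congr (_, _); last by rewrite Zp_add0z.
by apply/ffunP=> i; rewrite !ffunE mul1g Zp_addC Zp_add0z.
Qed.

Lemma wr_mulV : left_inverse wr_one wr_inv wr_mul.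
Proof.
move=> [x a]; rewrite /wr_mul /wr_one /=; congr (_, _); last by rewrite Zp_addNz.
by apply/ffunP=> i; rewrite !ffunE mulVg.
Qed.

HB.instance Definition _ := Finite_isGroup.Build wreath wr_mulA wr_mul1 wr_mulV.

Definition wbase (x : {ffun I -> gT}) : wreath := (x, Zp0).
Definition wtau : wreath := ([ffun => 1], Zp1).
Definition wdiag (g : gT) : wreath := wbase [ffun => g].

Definition wpow (A : {set gT}) : {set wreath} :=
  [set wbase x | x in [set x : {ffun I -> gT} | [forall i, x i \in A]]].

Definition wproj (i : I) (u : wreath) : gT := u.1 i.

Definition d0 (b c : gT) : {ffun I -> gT} :=
  [ffun i => if val i == 1%N then b else b * c].
Definition wtheta (b c : gT) : wreath := wbase (d0 b c) * wtau.

End Wreath.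

Section CosetGraph.
Variable gT : finGroupType.
Implicit Types (G H : {set gT}) (g : gT) (A B C : {set gT}).

Definition cos_vert G H : {set {set gT}} := rcosets H G.

Definition cos_adj H g A B : bool :=
  [exists x in A, exists y in B, (y * x^-1) \in (H :* g) * H].

Definition cos_rel G H g : rel {set gT} :=
  fun A B => [&& A \in cos_vert G H, B \in cos_vert G H & cos_adj H g A B].

Definition cos_connected G H g : Prop :=
  forall A B, A \in cos_vert G H -> B \in cos_vert G H ->
    connect (cos_rel G H g) A B.

Definition cos_valency G H g (k : nat) : Prop :=
  forall A, A \in cos_vert G H -> #|[set B | cos_rel G H g A B]| = k.

Definition cos_2arc G H g (a b c : {set gT}) : bool :=
  [&& cos_rel G H g a b, cos_rel G H g b c, a != b, b != c & a != c].

Definition cos_2arc_transitive G H g : Prop :=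
  forall a b c a' b' c',
    cos_2arc G H g a b c -> cos_2arc G H g a' b' c' ->
    exists2 z, z \in G & [/\ a :* z = a', b :* z = b' & c :* z = c'].

End CosetGraph.

Definition AGL1 (K : finFieldType) : {set {perm K}} :=
  [set s : {perm K} | [exists a : K, exists b : K,
     (a != 0)%R && [forall x, s x == (a * x + b)%R]]].

(* Main.v *)
Require Import Defs.
From HB Require Import structures.
From mathcomp Require Import all_boot all_order all_algebra all_fingroup all_solvable all_field.
Import GroupScope.

(* Since b has odd order and c^2 = 1, theta^(q+1) = diag(b^2 c) generates the diagonal copy of <b> x <c>; as c is the only possible image of c under o, the involution diag(o) normalises <theta>. The group H = E:<theta> acts 2-transitively on H/<theta>, so H meets H^diag(o) in <theta>: otherwise diag(o) would normalise E, hence o would normalise F and F would be normal in X = <F, b, c, o>. This gives the valency |E| and 2-arc-transitivity.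

For connectedness, L = <H, diag(o)> maps onto X in every coordinate. The kernels of the coordinate projections of E have the same order and are distinct, so for i <> j some element of L in T^n is trivial at j and non-trivial at i; commutators and the simplicity of T then give T^n <= L. The inclusion F <= T, needed for H <= G, holds because |F : F n T| <= 2 < |F| and AGL_1(q) fuses the elements of order p. *)

(** * Coset graphs: adjacency, connectedness, valency and 2-arcs *)

Section CosetGraphs.
Set Implicit Arguments.
Unset Strict Implicit.
Variable gT : finGroupType.
Implicit Types (G H D E L : {group gT}) (g x y : gT).

(** The double coset [H g H] absorbs factors from [H] on both sides, so the representatives
    quantified in [cos_adj] may be fixed. *)
Lemma cos_relE G H g x y : x \in G -> y \in G ->
  cos_rel G H g (H :* x) (H :* y) = (y * x^-1 \in (H :* g) * H).
Proof.
move=> Gx Gy; rewrite /cos_rel /cos_vert !mem_rcosets.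
rewrite !(subsetP (mulG_subr _ _)) //=; apply/existsP/idP.
  case=> _ /andP[/rcosetP[h Hh ->] /existsP[_ /andP[/rcosetP[k Hk ->]]]].
  rewrite invMg !mulgA => /mulsgP[_ v /rcosetP[u Hu ->] Hv].
  move/(congr1 (fun z => k^-1 * z * h)); rewrite !mulgA mulVg mul1g mulgKV => ->.
  apply/mulsgP; exists (k^-1 * u * g) (v * h); rewrite ?groupM //.
    by apply/rcosetP; exists (k^-1 * u); rewrite ?groupM ?groupV.
  by rewrite !mulgA.
move=> HgH; exists x; rewrite rcoset_refl /=.
by apply/existsP; exists y; rewrite rcoset_refl.
Qed.

Lemma cos_vertP G H A :
  reflect (exists2 x, x \in G & A = H :* x) (A \in cos_vert G H).
Proof. exact: rcosetsP. Qed.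

(** The multipliers [w] that keep every [H z] connected to [H w z] form a group [S]. It contains
    [g], since [H g z] is a neighbour of [H z], and [H], since [H h z = H z]. *)
Lemma connected_coset_graph G H g :
  H \subset G -> g \in G -> G \subset <<g |: H>> -> cos_connected G H g.
Proof.
move=> sHG Gg sGgen.
pose S := [set w in G | [forall z in G,
  connect (cos_rel G H g) (H :* z) (H :* (w * z))]].
have SP w : reflect (w \in G /\ forall z, z \in G ->
    connect (cos_rel G H g) (H :* z) (H :* (w * z))) (w \in S).
  rewrite inE; apply: (iffP andP) => [] [Gw] /forall_inP; by [].
have gS : group_set S.
  apply/group_setP; split.
    by apply/SP; split=> // z _; rewrite mul1g connect0.
  move=> u v /SP[Gu Su] /SP[Gv Sv]; apply/SP; split; first exact: groupM.
  move=> z Gz; apply: connect_trans (Sv z Gz) _.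
  by rewrite -mulgA Su // groupM.
have sGS : G \subset S.
  apply: subset_trans sGgen _; rewrite (gen_subG _ (group gS)) subUset sub1set.
  apply/andP; split; last apply/subsetP=> h Hh; apply/SP.
    split=> // z Gz; apply: connect1; rewrite cos_relE ?groupM // mulgK.
    by rewrite -[X in X \in _]mulg1 mem_mulg ?rcoset_refl.
  split=> [|z Gz]; first exact: (subsetP sHG).
  by rewrite rcosetM (rcoset_id Hh) connect0.
move=> A B /cos_vertP[x Gx ->] /cos_vertP[y Gy ->].
have /(subsetP sGS)/SP[_ /(_ x Gx)] : y * x^-1 \in G by rewrite groupM ?groupV.
by rewrite mulgKV.
Qed.

(* The neighbours of [H] are the cosets [H g e], [e] in [E]; on them [H] acts as on [H / D], which is the affine action of [E : D] on [E]. *)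
Section Frobenius.
Variables (G H D E : {group gT}) (g : gT).
Hypotheses (sHG : H \subset G) (Gg : g \in G) (ED : E * D = H).
Hypotheses (tiED : E :&: D = 1) (nED : D \subset 'N(E)) (nDg : g \in 'N(D)).
Hypotheses (g2 : g * g = 1) (sHgD : H :&: H :^ g \subset D).
Hypothesis trD : [transitive D, on E^# | 'J].

Let sEH : E \subset H. Proof. by rewrite -ED mulG_subl. Qed.
Let sDH : D \subset H. Proof. by rewrite -ED mulG_subr. Qed.
Let gV : g^-1 = g. Proof. by rewrite -[LHS]mulg1 -g2 mulKg. Qed.

Let Hgd d : d \in D -> H :* (g * d) = H :* g.
Proof.
move=> Dd; have Hd: d ^ g^-1 \in H by rewrite (subsetP sDH) ?memJ_norm ?groupV.
by rewrite conjgCV rcosetM (rcoset_id Hd).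
Qed.

Let sym A B : cos_rel G H g A B -> cos_rel G H g B A.
Proof.
move=> AB; have /and3P[/cos_vertP[x Gx Ax] /cos_vertP[y Gy By] _] := AB.
move: AB; rewrite {}Ax {}By !cos_relE //.
case/mulsgP=> _ k /rcosetP[h Hh ->] Hk /(congr1 invg); rewrite !invMg invgK => ->.
apply/mulsgP; exists (k^-1 * g) h^-1; rewrite ?groupV // ?gV ?mulgA //.
by apply/rcosetP; exists k^-1; rewrite ?groupV.
Qed.

(** Write the right factor of [H g H] as [D E]: the part in [D] passes through [g] and is absorbed
    by [H]. *)
Let nbrP y B : y \in G ->
  reflect (exists2 e, e \in E & B = H :* (g * (e * y)))
          (cos_rel G H g (H :* y) B).
Proof.
move=> Gy; apply: (iffP idP) => [yB | [e Ee ->]].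
  have /and3P[_ /cos_vertP[z Gz Bz] _] := yB; move: yB; rewrite {}Bz cos_relE //.
  case/mulsgP=> _ k /rcosetP[h Hh ->] Hk Dz.
  have: k \in D * E by rewrite (normC nED) ED.
  case/mulsgP=> d e Dd Ee Dk; exists e => //.
  rewrite -(mulgKV y z) Dz Dk -!mulgA rcosetM (rcoset_id Hh).
  by rewrite mulgA rcosetM (Hgd Dd) -rcosetM.
have Ge : e \in G by rewrite (subsetP sHG) ?(subsetP sEH).
rewrite cos_relE ?groupM // mulgA mulgK mem_mulg ?rcoset_refl //.
exact: (subsetP sEH).
Qed.

(** Equality of two such cosets puts [e * e'^-1] in [H :&: H :^ g], hence in [E :&: D = 1]. *)
Let nbr_inj y : {in E &, injective (fun e => H :* (g * (e * y)))}.
Proof.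
move=> e e' Ee Ee' /= /rcoset_eqP.
rewrite mem_rcoset !invMg -!mulgA (mulgA y) mulgV mul1g (mulgA e) => Hee.
apply/eqP; rewrite eq_mulgV1 -in_set1 -[[set _]]tiED.
have Eee : e * e'^-1 \in E by rewrite groupM ?groupV.
rewrite inE Eee (subsetP sHgD) // inE (subsetP sEH) //=.
by rewrite mem_conjg conjgE invgK.
Qed.

Lemma coset_graph_valency : cos_valency G H g #|E|.
Proof.
move=> _ /cos_vertP[y Gy ->]; rewrite -(card_in_imset (@nbr_inj y)).
apply: eq_card => B; rewrite inE; apply/nbrP/imsetP=> // -[e Ee ->];
  by exists e.
Qed.

(** If the middle is [H y] and the ends are [H g e y] and [H g e' y], the translation by [w = e y]
    turns the ends into [H g] and [H g (e' e^-1)]. *)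
Let arc_normal A B C : cos_2arc G H g A B C ->
  exists2 w, w \in G & exists2 e, e \in E^# &
    [/\ A = H :* g :* w, B = H :* w & C = H :* (g * e) :* w].
Proof.
case/and5P=> AB BC _ _ neqAC; have BA := sym AB.
have /and3P[/cos_vertP[y Gy By] _ _] := BC; rewrite {}By in AB BC BA *.
case/nbrP: BA neqAC => // e Ee -> /=; case/nbrP: BC => // e' Ee' -> neq.
have Ge : e \in G by rewrite (subsetP sHG) ?(subsetP sEH).
have He := subsetP sEH e Ee; exists (e * y); first exact: groupM.
exists (e' * e^-1); last first.
  rewrite -!rcosetM -!mulgA mulKg; split=> //.
  by rewrite rcosetM (rcoset_id He).
rewrite !inE -eq_mulgV1 groupM ?groupV // andbT.
by apply: contraNneq neq => ->.
Qed.

(** After normalisation only the element of [E^#] varies. Right multiplication by [d] in [D] fixes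
    [H] and [H g] and sends [H g e] to [H g (e ^ d)]. *)
Lemma coset_graph_2arc_transitive : cos_2arc_transitive G H g.
Proof.
move=> A B C A' B' C' /arc_normal[w Gw [e Ee [-> -> ->]]].
move=> /arc_normal[w' Gw' [e' Ee' [-> -> ->]]].
have /imsetP[d Dd /= De'] : e' \in orbit 'J D e by rewrite (atransP trD).
have Hd := subsetP sDH _ Dd.
exists (w^-1 * (d * w')); first by rewrite !groupM ?groupV // (subsetP sHG).
rewrite -!rcosetM !mulgA !mulgK; split.
- by rewrite (rcosetM H (g * d)) (Hgd Dd) -rcosetM.
- by rewrite mulgV mul1g rcosetM (rcoset_id Hd).
have ->: g * e * d = g * d * (e ^ d) by rewrite -!mulgA -conjgC.
by rewrite De' /= -!(mulgA _ _ w') (rcosetM H (g * d)) (Hgd Dd) -rcosetM !mulgA.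
Qed.

End Frobenius.
End CosetGraphs.

(** * The base group of the wreath product and its coordinate projections *)

Section WreathBase.
Set Implicit Arguments.
Unset Strict Implicit.
Variables (gT : finGroupType) (m : nat).
Implicit Types (u v w : wreath gT m) (i j : 'I_m.+1) (A : {group gT}).

Lemma wmul1E u v i : (u * v).1 i = u.1 i * v.1 (Zp_add i u.2).
Proof. by have -> : u * v = wr_mul u v by []; rewrite ffunE. Qed.

Lemma wmul2E u v : (u * v).2 = Zp_add u.2 v.2.
Proof. by []. Qed.

Lemma wbase_mulE u v i : u.2 = Zp0 -> (u * v).1 i = u.1 i * v.1 i.
Proof. by move=> u0; rewrite wmul1E u0 Zp_addC Zp_add0z. Qed.

Lemma wconj1E u v i : v.2 = Zp0 ->
  (v ^ u).1 i = v.1 (Zp_add i (Zp_opp u.2)) ^ u.1 (Zp_add i (Zp_opp u.2)).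
Proof.
move=> v0; rewrite !conjgE wmul1E wbase_mulE //.
by have -> : u^-1 = wr_inv u by []; rewrite ffunE.
Qed.

Lemma wconj2E u v : v.2 = Zp0 -> (v ^ u).2 = Zp0.
Proof.
move=> v0; rewrite conjgE !wmul2E v0 Zp_add0z.
by have -> : u^-1 = wr_inv u by []; rewrite /= Zp_addNz.
Qed.

Lemma wexpg2E u k : (u ^+ k).2 = inZp (u.2 * k).
Proof.
elim: k => [|k IHk]; first by rewrite muln0; apply: val_inj; rewrite /= mod0n.
rewrite expgSr wmul2E IHk; apply: val_inj; rewrite /= modnDml mulnS addnC.
by rewrite (addnC u.2).
Qed.

Lemma wbase_eq u v : u.2 = Zp0 -> v.2 = Zp0 -> u.1 =1 v.1 -> u = v.
Proof.
by case: u v => [x a] [y e] /= -> -> xy; congr (_, _); apply/ffunP.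
Qed.

Lemma wpowP (A : {set gT}) u :
  reflect (u.2 = Zp0 /\ forall i, u.1 i \in A) (u \in wpow m A).
Proof.
apply: (iffP imsetP) => [[x] | [u0 Au]].
  by rewrite inE => /forallP Ax -> /=.
exists u.1; first by rewrite inE; apply/forallP.
exact: wbase_eq.
Qed.

Lemma wpow_group_set A : group_set (wpow m A).
Proof.
apply/group_setP; split=> [|u v /wpowP[u0 Au] /wpowP[v0 Av]].
  by apply/wpowP; split=> // i; rewrite ffunE.
apply/wpowP; split=> [|i]; first by rewrite wmul2E u0 v0 Zp_add0z.
by rewrite wbase_mulE ?groupM.
Qed.
Canonical wpow_group A := Group (wpow_group_set A).

Lemma wpow_sub (A B : {set gT}) : A \subset B -> wpow m A \subset wpow m B.
Proof.
move=> /subsetP sAB; apply/subsetP=> u /wpowP[u0 Au].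
by apply/wpowP; split=> // i; apply: sAB.
Qed.

Lemma wpow_norm (A : {set gT}) u :
  (forall i, u.1 i \in 'N(A)) -> u \in 'N(wpow m A).
Proof.
move=> Nu; rewrite inE; apply/subsetP=> _ /imsetP[v /wpowP[v0 Av] ->].
by apply/wpowP; split=> [|i]; rewrite (wconj2E, wconj1E) ?memJ_norm.
Qed.

(** A shift in the left factor moves the coordinates of the right one, hence the restriction to the
    base group. *)
Lemma wproj_morphM i : {in wpow m [set: gT] &, {morph wproj i : u v / u * v}}.
Proof. by move=> u v /wpowP[u0 _] _; rewrite /wproj wbase_mulE. Qed.
Canonical wproj_morphism i := Morphism (wproj_morphM i).

Lemma wdiag_morphM : {in [set: gT] &, {morph wdiag m : x y / x * y}}.
Proof.
move=> x y _ _; apply: wbase_eq => [||i] //; first by rewrite wmul2E Zp_add0z.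
by rewrite wbase_mulE // !ffunE.
Qed.
Canonical wdiag_morphism := Morphism wdiag_morphM.

(* Commuting an element killed by [wproj j] for [j] in [s] with one killed by [wproj j0] kills all the coordinates in [j0 :: s]. *)
Lemma wpow_simple_sub (T X : {group gT}) (L : {group wreath gT m}) :
    0 < m -> simple T -> ~~ abelian T -> T <| X ->
    (forall i, X \subset wproj i @* (L :&: wpow m X)) ->
    (forall i j, i != j ->
       exists2 u, u \in L :&: wpow m T & u.1 j = 1 /\ u.1 i != 1) ->
  wpow m T \subset L.
Proof.
move=> m_gt0 /simpleP[_ simT] nabT /andP[sTX nTX] projX sepT.
pose K s := L :&: wpow m T :&: \bigcap_(j <- s) 'ker (wproj_morphism j).
have wX : wpow m X \subset wpow m [set: gT] by rewrite wpow_sub ?subsetT.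
have wT : wpow m T \subset wpow m [set: gT] by rewrite wpow_sub ?subsetT.
have kerP j u : u \in wpow m T -> (u \in 'ker (wproj_morphism j)) = (u.1 j == 1).
  by move=> Tu; rewrite !inE (subsetP wT).
have KP s u : reflect [/\ u \in L, u \in wpow m T & {in s, forall j, u.1 j = 1}]
                (u \in K s).
  rewrite /K !inE -andbA; apply: (iffP and3P) => [] [Lu Tu Ku]; split=> //.
    elim: s Ku => // j s IHs; rewrite big_cons inE kerP // => /andP[/eqP u1 Ku].
    by move=> k; rewrite inE => /predU1P[->|/IHs->].
  elim: s Ku => [|j s IHs] Ku; rewrite (big_nil, big_cons) inE // kerP //.
  by rewrite Ku ?mem_head ?eqxx ?IHs // => k sk; rewrite Ku // inE sk orbT.
have gK s : group_set (K s).
  apply/group_setP; split=> [|u v /KP[Lu Tu Ku] /KP[Lv Tv Kv]].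
    by apply/KP; split; rewrite ?group1 // => j _; rewrite ffunE.
  apply/KP; split; rewrite ?groupM // => j sj; have /wpowP[u0 _] := Tu.
  by rewrite wbase_mulE // Ku ?Kv ?mul1g.
pose gKs s : {group wreath gT m} := group (gK s).
have nTw v : v \in wpow m X -> v \in 'N(wpow m T).
  by case/wpowP=> _ Xv; rewrite wpow_norm // => i; rewrite (subsetP nTX).
have nK s : L :&: wpow m X \subset 'N(gKs s).
  apply/subsetP=> v /setIP[Lv Xv]; rewrite inE.
  apply/subsetP=> _ /imsetP[u /KP[Lu Tu Ku] ->].
  apply/KP; split=> [||j sj]; first exact: groupJ.
    by rewrite memJ_norm ?nTw.
  have [[u0 _] [v0 _]] := (wpowP _ _ Tu, wpowP _ _ Xv).
  have e0 : Zp_add j (Zp_opp v.2) = j.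
    by rewrite v0 Zp_addC; apply: val_inj; rewrite /= subn0 modnn add0n modn_small.
  by rewrite wconj1E // e0 Ku ?conj1g.
(* [L :&: wpow m X] normalises [K s] and projects onto [X], so the projection of [K s] is normal in
   [T]; being non-trivial, it is [T]. *)
have KT i s u : u \in K s -> u.1 i != 1 -> wproj i @* gKs s = T.
  move=> Ku ui; have nX : X \subset 'N(wproj i @* gKs s).
    by apply: subset_trans (projX i) _; rewrite morphim_norms.
  have sKT : wproj i @* gKs s \subset T.
    by apply/subsetP=> _ /morphimP[v _ /KP[_ /wpowP[_ Tv] _] ->]; apply: Tv.
  have /simT[K1|//] : wproj i @* gKs s <| T.
    by rewrite /normal sKT (subset_trans sTX).
  case/negP: ui; rewrite -in_set1 -[[set 1]]K1; apply: mem_morphim => //.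
  by have /KP[_ Tu _] := Ku; rewrite (subsetP wT).
have ntK i s : i \notin s -> exists2 u, u \in K s & u.1 i != 1.
  elim: s => [_|j s IHs].
    have [j nij] : exists j : 'I_m.+1, i != j.
      exists (if i == ord0 then ord_max else ord0).
      by case: (eqVneq i ord0) => [->|//]; rewrite -val_eqE /= eq_sym -lt0n.
    have [u /setIP[Lu Tu] [_ ui]] := sepT i j nij.
    by exists u => //; apply/KP.
  rewrite inE negb_or => /andP[nij /IHs[v Kv vi]].
  have [u /setIP[Lu Tu] [uj ui]] := sepT i j nij.
  have Ku : u \in K [:: j] by apply/KP; split=> // k; rewrite inE => /eqP->.
  have [x Tx [y Ty ncxy]] : exists2 x, x \in T & exists2 y, y \in T & [~ x, y] != 1.
    have /subsetPn[x Tx] := nabT; rewrite -sub_cent1 => /subsetPn[y Ty ncxy].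
    exists x => //; exists y => //; apply: contra ncxy => /commgP cxy.
    exact/cent1P.
  have: x \in wproj i @* gKs s by rewrite (KT i s v).
  have: y \in wproj i @* gKs [:: j] by rewrite (KT i [:: j] u).
  case/morphimP=> w' Dw' Kw' Dy /morphimP[w Dw Kw Dx].
  have Xw := subsetP (wpow_sub sTX) _.
  have [[Lw Tw sw] [Lw' Tw' sw']] := (KP _ _ Kw, KP _ _ Kw').
  (* [w'] normalises [K s] and [w] normalises [K [:: j]], so the commutator lies in both; its [i]-th
     coordinate is [[~ x, y]]. *)
  exists [~ w, w'].
    have Kc : [~ w, w'] \in gKs s.
      by rewrite commgEl groupMl ?groupV ?memJ_norm // (subsetP (nK s)) // inE Lw' Xw.
    have Kc' : [~ w, w'] \in gKs [:: j].
      by rewrite commgEr groupMr ?memJ_norm ?groupV // (subsetP (nK _)) // inE Lw Xw.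
    have [Lc Tc cs] := KP _ _ Kc; have [_ _ cj] := KP _ _ Kc'.
    by apply/KP; split=> // k; rewrite inE => /predU1P[->|/cs//]; rewrite cj ?inE.
  by move: ncxy; rewrite Dx Dy -(morphR (wproj_morphism i)).
have single i t : t \in T -> wbase [ffun k => if k == i then t else 1] \in L.
  (* Taking for [s] all coordinates except [i] leaves elements supported at [i] alone. *)
  have nis : i \notin rem i (enum 'I_m.+1) by rewrite mem_rem_uniqF ?enum_uniq.
  have [u Ku ui] := ntK i _ nis.
  rewrite -(KT i _ u Ku ui) => /morphimP[v _ /KP[Lv /wpowP[v0 _] sv] ->].
  suff <- : v = wbase [ffun k => if k == i then wproj i v else 1] by [].
  apply: wbase_eq => // k; rewrite ffunE; case: eqVneq => [->//|nki].
  by rewrite sv // (rem_filter _ (enum_uniq _)) mem_filter /= nki mem_enum.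
have supp (s : seq 'I_m.+1) u : u \in wpow m T -> (forall j, j \notin s -> u.1 j = 1) -> u \in L.
  elim: s u => [|i s IHs] u Tu us.
    suff -> : u = 1 by rewrite group1.
    by have [u0 _] := wpowP _ _ Tu; apply: wbase_eq => // j; rewrite us ?ffunE.
  have [u0 uT] := wpowP _ _ Tu.
  pose v : wreath gT m := wbase [ffun k => if k == i then u.1 i else 1].
  have Tv : v \in wpow m T.
    by apply/wpowP; split=> // k; rewrite ffunE; case: ifP.
  rewrite -(mulgKV v u) groupM ?single // IHs ?groupM ?groupV // => j sj.
  have Dv := subsetP wT v Tv; have Du := subsetP wT u Tu.
  rewrite -[LHS]/(wproj j (u * v^-1)) morphM ?groupV // morphV //.
  rewrite /= /wproj ffunE; case: eqVneq => [->|nji]; first by rewrite mulgV.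
  by rewrite us ?invg1 ?mulg1 // inE negb_or nji.
by apply/subsetP=> u Tu; apply: (supp (enum 'I_m.+1)) => // j; rewrite mem_enum.
Qed.

End WreathBase.

(** * Powers of [theta] and conjugation by diagonal elements *)

Section Theta.
Set Implicit Arguments.
Unset Strict Implicit.
Variables (gT : finGroupType) (m : nat).
Implicit Types (u : wreath gT m) (x b c : gT).

(** Constant tuples are invariant under shifts, so [u] may lie outside the base group. *)
Lemma wconj_diag1E u x i : (u ^ wdiag m x).1 i = u.1 i ^ x.
Proof.
rewrite !conjgE -(morphV (wdiag_morphism gT m)) ?inE // !wmul1E !ffunE.
by rewrite Zp_addC Zp_add0z mulgA.
Qed.

Lemma wconj_diag2E u x : (u ^ wdiag m x).2 = u.2.
Proof.
rewrite conjgE -(morphV (wdiag_morphism gT m)) ?inE // !wmul2E /= Zp_add0z.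
by rewrite Zp_addC Zp_add0z.
Qed.

Lemma wthetaE1 b c i : (wtheta m b c).1 i = if val i == 1%N then b else b * c.
Proof. by rewrite wbase_mulE // !ffunE mulg1. Qed.

(** Coordinate [i] collects the entries of [d0] at [i], ..., [i + k - 1] modulo [m.+1]; each gives
    one [b], and one [c] unless its index is [1]. *)
Lemma wthetaX b c k : commute b c ->
  wtheta m b c ^+ k =
    ([ffun i => b ^+ k * c ^+ \sum_(j < k) (val (Zp_add i (inZp j)) != 1%N)],
     inZp k).
Proof.
move=> cbc; elim: k => [|k IHk].
  congr (_, _); last by apply: val_inj; rewrite /= mod0n.
  by apply/ffunP=> i; rewrite !ffunE big_ord0 mulg1.
rewrite expgSr IHk; apply: injective_projections.
  apply/ffunP=> i; rewrite wmul1E wthetaE1 !ffunE big_ord_recr.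
  set e := \sum_(j < k) _.
  have ->: (if val (Zp_add i (inZp k)) == 1%N then b else b * c)
      = b * c ^+ (val (Zp_add i (inZp k)) != 1%N).
    by case: eqP; rewrite /= ?mulg1 ?expg1.
  rewrite expgSr expgD !mulgA; congr (_ * _).
  by rewrite -!mulgA; congr (_ * _); apply: commute_sym; apply: commuteX.
by apply: val_inj; rewrite /= add0n modn_mod modnDm addn1.
Qed.

(** In [m.+1] steps the index runs once through ['I_m.+1], and [0 < m] ensures that the exceptional
    index [1] is among its values. *)
Lemma wtheta_expn b c : 0 < m -> commute b c ->
  wtheta m b c ^+ m.+1 = wdiag m (b ^+ m.+1 * c ^+ m).
Proof.
move=> m_gt0 cbc; rewrite wthetaX //; congr (_, _); last first.
  by apply: val_inj; rewrite /= modnn.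
apply/ffunP=> i; rewrite !ffunE; congr (_ * _ ^+ _).
have addK : cancel (Zp_add i) (Zp_add (Zp_opp i)).
  by move=> j; rewrite Zp_addA Zp_addNz Zp_add0z.
pose i1 : 'I_m.+1 := inord 1.
rewrite (eq_bigr (fun j => (Zp_add i j != i1) : nat)); last first.
  by move=> j _; rewrite valZpK -val_eqE /= inordK.
transitivity #|predC1 i1|; last by rewrite cardC1 card_ord.
rewrite -sum1_card [RHS]big_mkcond [RHS](reindex_inj (can_inj addK)).
by apply: eq_bigr => j _; rewrite inE; case: (_ == i1).
Qed.

End Theta.

(** * Conjugacy of translations in the affine group *)

Section AffineGroup.
Set Implicit Arguments.
Unset Strict Implicit.

Lemma AGL1_group_set (K : finFieldType) : group_set (AGL1 K).
Proof.
apply/group_setP; split=> [|s t]; rewrite !inE.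
  apply/existsP; exists 1%R; apply/existsP; exists 0%R.
  rewrite GRing.oner_neq0; apply/forallP=> z.
  by rewrite perm1 GRing.mul1r GRing.addr0.
case/existsP=> a /existsP[u /andP[a0 /forallP su]].
case/existsP=> e /existsP[v /andP[e0 /forallP tv]].
apply/existsP; exists (e * a)%R; apply/existsP; exists (e * u + v)%R.
rewrite GRing.mulf_neq0 //; apply/forallP=> z.
by rewrite permM (eqP (tv _)) (eqP (su _)) GRing.mulrDr GRing.mulrA GRing.addrA.
Qed.
Canonical AGL1_group K := Group (AGL1_group_set K).

(** The equations [x ^+ p = 1] and [y ^+ p = 1] force slope [1], so [x] and [y] act as translations
    by non-zero [v] and [w]; scaling by [w / v] conjugates the first to the second. *)
Lemma AGL1_pconj (gT : finGroupType) (K : finFieldType) (R : {group gT}) p x y :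
    p %| #|K| -> R \isog AGL1_group K -> x \in R -> y \in R ->
    x ^+ p = 1 -> y ^+ p = 1 -> x != 1 -> y != 1 ->
  exists2 g, g \in R & y = x ^ g.
Proof.
move=> /dvdnP[k Kpk] /isogP[h /injmP injh imh] Rx Ry xp yp nx ny.
have hP u : u \in R -> u ^+ p = 1 -> u != 1 ->
    exists2 v : K, v != 0%R & forall z, h u z = (z + v)%R.
  move=> Ru up nu; have: h u \in AGL1 K by rewrite -imh mem_morphim.
  rewrite inE => /existsP[a /existsP[v /andP[a0 /forallP huE]]].
  have hu z : h u z = (a * z + v)%R by apply/eqP.
  (* The slope of an affine map is its value at [1] minus its value at [0]. *)
  have hX j (s : {perm K} := h u ^+ j) : (s 1 - s 0 = a ^+ j)%R.
    rewrite {}/s; elim: j => [|j IHj]; first by rewrite expg0 !perm1 GRing.subr0 GRing.expr0.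
    by rewrite expgSr !permM !hu GRing.exprS -IHj GRing.opprD GRing.addrACA
               GRing.subrr GRing.addr0 GRing.mulrBr.
  have ap : (a ^+ p = 1)%R.
    by rewrite -hX -morphX // up morph1 !perm1 GRing.subr0.
  (* [a] equals its [#|K|]-th power, which is a power of [a ^ p = 1]. *)
  have a1 : a = 1%R by rewrite -(expf_card a) Kpk mulnC GRing.exprM ap GRing.expr1n.
  have {}hu z : h u z = (z + v)%R by rewrite hu a1 GRing.mul1r.
  exists v => //; apply: contra nu => /eqP v0.
  apply/eqP; apply: injh; rewrite ?group1 // morph1.
  by apply/permP=> z; rewrite hu v0 GRing.addr0 perm1.
have [v v0 hx] := hP x Rx xp nx; have [w w0 hy] := hP y Ry yp ny.
have wv0 : (w / v != 0)%R by rewrite GRing.mulf_neq0 ?GRing.invr_eq0.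
pose s := perm (GRing.mulfI wv0).
have: s \in h @* R.
  rewrite imh inE; apply/existsP; exists (w / v)%R; apply/existsP; exists 0%R.
  by rewrite wv0; apply/forallP=> z; rewrite permE GRing.addr0.
case/morphimP=> g _ Rg sE; exists g => //.
apply: injh; rewrite ?groupJ // morphJ // -sE.
apply: (mulgI s); rewrite -conjgC; apply/permP=> z.
by rewrite !permM hx hy !permE GRing.mulrDr GRing.divfK.
Qed.

End AffineGroup.

(** * Arithmetic of the orders of [b] and [c] *)

Section Orders.
Set Implicit Arguments.
Unset Strict Implicit.

(** For odd [q], [4] divides [q + 1], so [q - 1] is twice an odd number; for even [q], [q - 1]
    itself is odd. *)
Lemma complement_powers q s t r (gT : finGroupType) (b c : gT) :
    q.+1 = (2 ^ s * r ^ t)%N -> (3 < q.+1)%N -> (2 <= s)%N || ~~ odd q ->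
    #[b] = ((q - 1) %/ gcdn 2 (q - 1))%N -> #[c] = gcdn 2 (q - 1) ->
  [/\ odd #[b], b ^+ (q - 1) = 1, c ^+ 2 = 1, c ^+ (q - 1) = 1 & c ^+ q = c].
Proof.
move=> Dq1 q_gt2 sq ob oc.
have c2 : c ^+ 2 = 1 by apply/eqP; rewrite -order_dvdn oc dvdn_gcdl.
have cq1 : c ^+ (q - 1) = 1 by apply/eqP; rewrite -order_dvdn oc dvdn_gcdr.
have bq1 : b ^+ (q - 1) = 1.
  by apply/eqP; rewrite -order_dvdn ob dvdn_div // dvdn_gcdr.
have q_gt0 : 0 < q by case: (q) q_gt2.
have cq : c ^+ q = c by rewrite -[in LHS](subnK q_gt0) expgD cq1 mul1g.
split=> //; rewrite ob; case q_odd: (odd q) sq => /=; last first.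
  move=> _; have o2: odd (q - 1) by rewrite oddB // q_odd.
  have -> : gcdn 2 (q - 1) = 1%N by apply/eqP; rewrite -/(coprime 2 _) coprime2n.
  by rewrite divn1.
rewrite orbF => s_ge2; have /dvdnP[k Dk] : 4 %| q.+1.
  by rewrite Dq1 dvdn_mulr // (dvdn_exp2l 2 s_ge2).
have Dk1 : q - 1 = (k.-1.*2.+1 * 2)%N.
  case: k Dk => // k; rewrite mulSn => -[->].
  by rewrite -[(3 + _)%N]/((2 + k * 4).+1) subn1 mulSn -muln2 -mulnA.
by rewrite Dk1 (gcdn_idPl _) ?dvdn_mull // mulnK //= odd_double.
Qed.

End Orders.

(** * The graph attached to [H = E:<theta>] and the diagonal involution *)

Theorem theorem6p4
  (gT : finGroupType) (p f q s t r : nat)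
  (X T R F : {group gT}) (b c o : gT) (E : {group wreath gT q}) :
  (* (C1) *)
  prime p -> (0 < f)%N -> q = (p ^ f)%N ->
  q.+1 = (2 ^ s * r ^ t)%N -> (3 < q.+1)%N -> prime r -> odd r ->
  (2 <= s)%N || ~~ odd q ->
  (* (C2): X almost simple with socle T, |X:T| <= 2 *)
  T <| X -> simple T -> ~~ abelian T -> 'C_X(T) = 1 -> (#|X : T| <= 2)%N ->
  (* R <= X, R isomorphic to AGL_1(q), R = F:(<b> x <c>) *)
  R \subset X ->
  (exists K : finFieldType, #|K| = q /\ R \isog AGL1 K) ->
  F ><| (<[b]> \x <[c]>) = R ->
  p.-abelem F -> #|F| = (p ^ f)%N ->
  #[b] = ((q - 1) %/ gcdn 2 (q - 1))%N -> #[c] = gcdn 2 (q - 1) ->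
  (* E minimal normal in F^n:<theta> with properties (1)-(3) *)
  let theta := wtheta q b c in
  let G := wpow q T * <[theta]> in
  E \subset wpow q F * <[theta]> ->
  minnormal E (wpow q F * <[theta]>) ->
  p.-abelem E -> #|E| = (p ^ (2 * f))%N ->
  [transitive <[theta]>, on E^# | 'J] ->
  (forall i : 'I_q.+1, wproj i @: E = F) ->
  (forall i j : 'I_q.+1, (i < j)%N ->
     [set u in E | wproj i u == 1] != [set u in E | wproj j u == 1]) ->
  let H := (E : {set wreath gT q}) * <[theta]> in
  (* the involution o *)
  o \in 'N_X(<<[set b; c]>>) -> o \in T -> #[o] = 2 ->
  (X : {set gT}) = << (F :|: [set b; c; o]) >> ->
  let og := wdiag q o in
  [/\ cos_connected G H og,
      cos_2arc_transitive G H og &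
      cos_valency G H og (q ^ 2)%N].
Proof.
move=> pp f_gt0 Dq Dq1 q_gt2 pr_r odd_r sq nTX simT nabT _ iTX sRX [K [oK isoR]].
move=> DR abF oF ob oc theta G _ minE abE oE trE projE kerE H Nbo To o_2 DX og.
have [odd_b bq1 c2 cq1 cq] := complement_powers Dq1 q_gt2 sq ob oc.
have [[_ Zg _ DZ] DFZ nFZ tiFZ] := sdprodP DR.
have [_ Dbc cbc' _] := dprodP DZ; rewrite DZ in DFZ nFZ tiFZ.
have sZR : Zg \subset R by rewrite -DFZ mulG_subr.
have Zb : b \in Zg by rewrite -Dbc (subsetP (mulG_subl _ _)) ?cycle_id.
have Zc : c \in Zg by rewrite -Dbc (subsetP (mulG_subr _ _)) ?cycle_id.
have [Rb Rc] : b \in R /\ c \in R by rewrite !(subsetP sZR).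
have [cbc cb2c] : commute b c /\ commute (b ^+ 2) c.
  suff cbc : commute b c by split=> //; apply/commute_sym/commuteX/commute_sym.
  by apply/commute_sym/cent1P; rewrite -cent_cycle (subsetP cbc') ?cycle_id.
have defFR : F <| R.
  by rewrite /normal -DFZ mulG_subl mul_subG ?normG.
have [sTX nTX'] := andP nTX.
have sFX : F \subset X := subset_trans (normal_sub defFR) sRX.
have p_gt1 := prime_gt1 pp.
have ntF : F :!=: 1.
  by rewrite -cardG_gt1 oF -{1}(expn0 p) ltn_exp2l.
have abelF : abelian F := abelem_abelian abF.
have sFT : F \subset T.
  have ntFT : F :&: T :!=: 1.
    (* [F] would then inject into the cosets of [T] in [X], giving [q <= 2]. *)
    apply: contraL q_gt2 => /eqP FT1; rewrite -leqNgt ltnS Dq -oF.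
    rewrite -indexg1 -FT1 indexgI.
    exact: leq_trans (subset_leq_card (imsetS _ sFX)) iTX.
  have /trivgPn[x /setIP[Fx Tx] ntx] := ntFT.
  apply/subsetP=> y Fy; have [->|nty] := eqVneq y 1; first exact: group1.
  have Fp z : z \in F -> z ^+ p = 1 by case/(abelemP pp): abF => _; apply.
  have sFR := subsetP (normal_sub defFR).
  have pK : p %| #|K| by rewrite oK Dq dvdn_exp.
  have [] := AGL1_pconj pK isoR (sFR x Fx) (sFR y Fy) (Fp x Fx) (Fp y Fy) ntx nty.
  by move=> g Rg ->; rewrite memJ_norm // (subsetP nTX') // (subsetP sRX).
have not_norm_oF : o \notin 'N(F).
  apply/negP=> nFo; have nFX : F <| X.
    rewrite /normal sFX DX gen_subG !subUset !sub1set normG.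
    by rewrite nFo !(subsetP (normal_norm defFR) _) // Rb.
  have /simpleP[_ /(_ F)] := simT; case=> [|F1|FT].
  - by rewrite /normal sFT (subset_trans sTX) ?(normal_norm nFX).
  - by rewrite F1 eqxx in ntF.
  by rewrite -FT abelF in nabT.
have q_gt0 : 0 < q by exact: ltnW (ltnW q_gt2).
(* The order of [theta] will turn out to divide this product. *)
have cop : coprime p ((q + 1) * (q - 1)).
  have pq : p %| q by rewrite Dq dvdn_exp.
  rewrite coprimeMr !prime_coprime // dvdn_addr //.
  by rewrite (dvdn_subr q_gt0 pq) dvdn1 andbb neq_ltn p_gt1 orbT.
have thetan : theta ^+ q.+1 = wdiag q (b ^+ 2 * c).
  rewrite wtheta_expn // cq; congr (wdiag q (_ * _)).
  by rewrite -[in LHS](subnK q_gt0) -addnS expgD bq1 mul1g.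
have thE i : theta.1 i = if val i == 1%N then b else b * c := wthetaE1 b c i.
have sZD x : x \in <<[set b; c]>> -> wdiag q x \in <[theta]>.
  pose P := (wdiag_morphism gT q @*^-1 <[theta]>)%G.
  have PP y : (y \in P) = (wdiag q y \in <[theta]>) by rewrite !inE.
  have Pa : b ^+ 2 * c \in P by rewrite PP -thetan mem_cycle.
  (* The square of [b^2 c] is [b^4], which generates [<[b]>] because [#[b]] is odd. *)
  have Pb : b \in P.
    have : b \in <[b ^+ 4]>.
      have: generator <[b]> (b ^+ 4).
        by rewrite generator_coprime (coprimeXr 2 (n := 2)) // coprimen2.
      by move/eqP <-; apply: cycle_id.
    apply/subsetP; rewrite cycle_subG.
    suff <- : (b ^+ 2 * c) ^+ 2 = b ^+ 4 by apply: groupX.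
    by rewrite expgMn // c2 mulg1 -expgM.
  have Pc : c \in P by rewrite -(groupMl _ (groupX 2 Pb)).
  move=> Zx; rewrite -PP; apply: subsetP Zx.
  by rewrite gen_subG subUset !sub1set Pb.
have opD : coprime p #|<[theta]>|.
  apply: coprime_dvdr cop; rewrite order_dvdn addn1 expgM thetan.
  rewrite -(morphX (wdiag_morphism gT q)) ?inE //.
  by rewrite expgMn // -expgM mulnC expgM bq1 expg1n cq1 mulg1 morph1.
(* For [u] in [E], [u ^+ p = 1] makes [p] times the shift [u.2] vanish modulo [q + 1], which is
   prime to [p]; so the shift is zero. *)
have sEF : E \subset wpow q F.
  apply/subsetP=> u Eu; apply/wpowP; split=> [|i]; last by have := imset_f (wproj i) Eu; rewrite projE.
  have [_ /(_ u Eu) /(congr1 snd)] := abelemP pp abE.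
  rewrite [LHS]wexpg2E => /(congr1 val) /eqP /=; rewrite -/(q.+1 %| _) Gauss_dvdl.
    move=> u20; apply: val_inj => /=; apply/eqP; move: u20.
    by rewrite /dvdn modn_small.
  by rewrite coprime_sym; move: cop; rewrite coprimeMr addn1 => /andP[].
have nED : <[theta]> \subset 'N(E).
  have /andP[_ nE] := mingroupp minE.
  by apply: subset_trans nE; apply: mulG_subr (wpow_group q F) _.
have tiED : E :&: <[theta]> = 1.
  by apply: coprime_TIg; rewrite oE coprimeXl.
have nDo : og \in 'N(<[theta]>).
  have [_ /normP nZo] := setIP Nbo.
  have sZZ : <<[set b; c]>> \subset Zg by rewrite gen_subG subUset !sub1set Zb.
  have ZJ x : x \in <<[set b; c]>> -> x ^ o \in <<[set b; c]>>.
    by move=> Zx; rewrite -nZo memJ_conjg.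
  have [Gb Gc] : b \in <<[set b; c]>> /\ c \in <<[set b; c]>>.
    by rewrite !mem_gen // !inE eqxx ?orbT.
  (* [c ^ o] squares to [1], so its component in [<[b]>], of odd order, is trivial. It is thus [c]
     or [1], and [1] only if [c = 1]. *)
  have co : c ^ o = c.
    have := subsetP sZZ _ (ZJ c Gc); rewrite -Dbc => /mulsgP[_ _ /cycleP[i ->] /cycleP[j ->] Dco].
    have bi1 : b ^+ i = 1.
      have : (c ^ o) ^+ 2 = 1 by rewrite -conjXg c2 conj1g.
      rewrite Dco expgMn; last exact: commuteX2.
      rewrite -(expgM c) mulnC (expgM c) c2 expg1n mulg1 => /eqP.
      rewrite -order_dvdn => bi2; apply/eqP; rewrite -order_eq1 -dvdn1.
      have /eqP <- : coprime 2 #[b] by rewrite coprime2n.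
      by rewrite dvdn_gcd bi2 orderXdvd.
    move: Dco; rewrite bi1 mul1g -(odd_double_half j) expgD -mul2n expgM c2.
    rewrite expg1n mulg1; case: odd => // /eqP.
    by rewrite conjg_eq1 => /eqP->; rewrite conj1g.
  rewrite inE -cycleJ cycle_subG.
  (* As [o] fixes [c], every coordinate is multiplied on the left by the same [b ^ o * b^-1], whose
     diagonal image lies in [<[theta]>]. *)
  have -> : theta ^ og = wdiag q (b ^ o * b^-1) * theta.
    apply: injective_projections; last first.
      by rewrite wconj_diag2E wmul2E /= !Zp_add0z.
    apply/ffunP=> i; rewrite wconj_diag1E (@wbase_mulE _ _ (wdiag q _)) // !thE ffunE.
    by case: ifP; rewrite ?conjMg ?co ?mulgA mulgKV.
  by rewrite groupM ?cycle_id // sZD // groupM ?groupV ?ZJ.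
have nTD : <[theta]> \subset 'N(wpow q T).
  rewrite cycle_subG wpow_norm // => i; rewrite (subsetP nTX') // (subsetP sRX) //.
  by rewrite thE; case: ifP; rewrite ?groupM.
pose Hg := (E <*> <[theta]>)%G; pose Gg := (wpow_group q T <*> <[theta]>)%G.
have DH : H = Hg by rewrite /= norm_joinEr.
have DG : G = Gg by rewrite /= norm_joinEr.
have o2 : o * o = 1.
  by rewrite -[o * o]/(o ^+ 2) -o_2 expg_order.
have og2 : og * og = 1.
  by rewrite -(morphM (wdiag_morphism gT q)) ?inE // o2 (morph1 (wdiag_morphism gT q)).
have Tog : og \in wpow q T by apply/wpowP; split=> // i; rewrite ffunE.
have Gog : og \in Gg.
  by rewrite -[(Gg : {set _})]DG (subsetP (mulG_subl _ _)).
have sEG : E \subset wpow q T := subset_trans sEF (wpow_sub q sFT).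
have sHG : Hg \subset Gg by rewrite genS ?setSU.
have sHoD : Hg :&: Hg :^ og \subset <[theta]>.
  apply/subsetP=> x /setIP[]; rewrite -{1}DH => /mulsgP[e d Ee Dd ->] Hed.
  have sDHo : <[theta]> \subset Hg :^ og.
    by rewrite -(normP nDo) conjSg joing_subr.
  have He : e \in Hg :^ og by rewrite -(groupMr _ (subsetP sDHo d Dd)).
  have [->|nte] := eqVneq e 1; first by rewrite mul1g.
  have sEHo : E \subset Hg :^ og.
    apply/subsetP=> e' Ee'; have [->|nte'] := eqVneq e' 1; first exact: group1.
    have [||d' Dd' ->] := atransP2 trE (x := e) (y := e'); rewrite ?inE ?nte ?nte' //.
    by rewrite groupJ // (subsetP sDHo).
  (* [E] is the normal Sylow [p]-subgroup of [Hg], and [og * og = 1] turns [E \subset Hg :^ og] into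
     [E :^ og \subset Hg]. *)
  have sEoE : E :^ og \subset E.
    have hallE : p.-Hall(Hg) E.
      rewrite /pHall joing_subl (abelem_pgroup abE) -divgS ?joing_subl //.
      by rewrite -[#|Hg|]/#|(Hg : {set _})| -DH TI_cardMg // mulKn // p'natE // -prime_coprime.
    have nEH : E <| Hg by rewrite /normal joing_subl join_subG normG.
    rewrite (sub_normal_Hall hallE nEH) ?pgroupJ ?(abelem_pgroup abE) //.
    by rewrite -(conjSg _ _ og) -conjsgM og2 conjsg1.
  case/negP: not_norm_oF; rewrite inE; apply/subsetP=> _ /imsetP[x' Fx' ->].
  move: Fx'; rewrite -(projE ord0) => /imsetP[u Eu ->].
  apply/imsetP; exists (u ^ og); last by rewrite /wproj wconj_diag1E.
  by rewrite (subsetP sEoE) ?memJ_conjg.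
rewrite DG DH; split; last first.
- have <- : #|E| = (q ^ 2)%N by rewrite oE Dq -expnM mulnC.
  exact: (coset_graph_valency sHG Gog DH tiED nED nDo sHoD).
- exact: (coset_graph_2arc_transitive sHG Gog DH nED nDo og2 trE).
apply: connected_coset_graph => //.
pose L := <<og |: Hg>>%G.
have sHL : Hg \subset L by rewrite sub_gen ?subsetUr.
have sEL : E \subset L := subset_trans (joing_subl _ _) sHL.
have sDL : <[theta]> \subset L := subset_trans (joing_subr _ _) sHL.
suff sTL : wpow q T \subset L by rewrite join_subG sTL.
have sAT (A : {set gT}) : wpow q A \subset wpow q [set: gT].
  by rewrite wpow_sub ?subsetT.
apply: (wpow_simple_sub q_gt0 simT nabT nTX) => [i|i j nij].
  have memX u : u \in L -> u \in wpow q X -> u.1 i \in wproj i @* (L :&: wpow q X).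
    move=> Lu Xu; rewrite -[u.1 i]/(wproj_morphism gT i u) mem_morphim //.
      exact: subsetP (sAT X) u Xu.
    by rewrite inE Lu.
  have memd x : x \in X -> wdiag q x \in L -> x \in wproj i @* (L :&: wpow q X).
    move=> Xx Lx; have -> : x = (wdiag q x).1 i by rewrite ffunE.
    by rewrite memX //; apply/wpowP; split=> // k; rewrite ffunE.
  (* [F] comes from [E], [b] and [c] from diagonal elements of [<[theta]>], and [o] from [og]. *)
  rewrite {1}DX gen_subG !subUset !sub1set -!andbA; apply/and4P; split.
  - apply/subsetP=> x; rewrite -(projE i) => /imsetP[u Eu ->].
    rewrite memX ?(subsetP sEL) //.
    exact: subsetP (subset_trans sEF (wpow_sub q sFX)) u Eu.
  - by rewrite memd ?(subsetP sRX) // (subsetP sDL) // sZD // mem_gen // !inE eqxx.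
  - by rewrite memd ?(subsetP sRX) // (subsetP sDL) // sZD // mem_gen // !inE eqxx orbT.
  by rewrite memd ?(subsetP sTX) // mem_gen // setU11.
pose kerp k := [set u in E | wproj k u == 1].
(* All kernels have index [#|F|] in [E], so two distinct ones cannot be nested. *)
have cardK k : (#|kerp k| * #|F| = #|E|)%N.
  have sED : E \subset wpow q [set: gT] := subset_trans sEF (sAT F).
  have -> : kerp k = E :&: 'ker (wproj_morphism gT k).
    by apply/setP=> u; rewrite !inE; case Eu: (u \in E); rewrite // (subsetP sED).
  rewrite -(projE k) -(morphimEsub (wproj_morphism gT k)) // card_morphim.
  by rewrite (setIidPr sED) LagrangeI.
have eqK : #|kerp j| = #|kerp i|.
  by apply/eqP; rewrite -(eqn_pmul2r (cardG_gt0 F)) !cardK.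
have neqK : kerp j != kerp i.
  case: (ltngtP i j) => [/kerE|/kerE //|/val_inj eij]; first by rewrite eq_sym.
  by rewrite eij eqxx in nij.
have /subsetPn[u] : ~~ (kerp j \subset kerp i).
  by apply: contra neqK => sK; rewrite eqEcard sK eqK leqnn.
rewrite !inE => /andP[Eu /eqP uj]; rewrite Eu /= => ui.
by exists u; rewrite // inE (subsetP sEL) ?(subsetP sEG).
Qed.
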